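(* Let $S=\langle a_1,\ldots,a_r\rangle$ be a numerical semigroup and let $I(a_1,\ldots,a_r;q)=\sum_{I} q^{\operatorname{codim}(I)}$, the sum running over all ideals $I$ of $S$. Then there is a polynomial $f(q)\in\mathbb{Z}[q]$ such that \[I(a_1,\ldots,a_r;q)=\frac{f(q)}{1-q}.\] Moreover, $G(S)=\deg\big(I(a_1,\ldots,a_r;q)\big)=\deg(f(q))-1$.
   Context: $\mathbb{N}$ denotes the non-negative integers. A numerical semigroup is an additive submonoid $S$ of $(\mathbb{N},+)$ with $\mathbb{N}\setminus S$ finite; $\langle a_1,\ldots,a_r\rangle=\{a_1x_1+\cdots+a_rx_r : x_i\in\mathbb{N}\}$. The Frobenius number $G(S)$ is the largest integer not in $S$. A non-empty set $I\subseteq S$ is an ideal of $S$ if $I+S\subseteq I$; its codimension is $\operatorname{codim}(I)=|S\setminus I|$. The ideal generating function is the formal power series $I(a_1,\ldots,a_r;q)=\sum_{I}q^{\operatorname{codim}(I)}$ over all ideals $I$ of $S$. For a rational function $p(x)/q(x)$ its degree is $\deg p-\deg q$. *)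

(* Defs.v *)
From HB Require Import structures.
From mathcomp Require Import all_boot all_order all_algebra finmap zify.
From mathcomp Require Import boolp classical_sets functions cardinality.

Set Implicit Arguments.
Unset Strict Implicit.
Unset Printing Implicit Defensive.

Import Order.TTheory GRing.Theory Num.Theory.

Local Open Scope classical_set_scope.
Local Open Scope ring_scope.

Definition generated (r : nat) (a : 'I_r -> nat) : set nat :=
  [set n | exists x : 'I_r -> nat, n = (\sum_(i < r) a i * x i)%N].

Definition submonoid (S : set nat) : Prop :=
  S 0%N /\ forall m n, S m -> S n -> S (m + n)%N.

Definition numerical_semigroup (S : set nat) : Prop :=
  submonoid S /\ finite_set (~` S).

(* The Frobenius number lives in int: for S = N, the largest integer outside S
   is -1. *)
Definition int_gaps (S : set nat) : set int :=
  [set z | ~ exists2 s : nat, S s & z = s%:Z].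

Definition frobenius (S : set nat) : int :=
  xget 0 (int_gaps S `&` ubound (int_gaps S)).

Definition semigroup_ideal (S I : set nat) : Prop :=
  [/\ I !=set0, I `<=` S & forall i s, I i -> S s -> I (i + s)%N].

(* fset_set is empty on infinite sets; finite_ideal_compl and
   finite_ideals_of_codim below show that for a numerical semigroup both
   cardinals are taken of finite sets. *)
Definition codim (S I : set nat) : nat := #|` fset_set (S `\` I)|%fset.

Definition ideals_of_codim (S : set nat) (n : nat) : set (set nat) :=
  [set I | semigroup_ideal S I /\ codim S I = n].

(* Formal power series with integer coefficients are coefficient sequences. *)
Definition fps := nat -> int.

Definition fps_mul (s t : fps) : fps :=
  fun n => \sum_(i < n.+1) s i * t (n - i)%N.

Definition fps_of_poly (p : {poly int}) : fps := fun n => p`_n.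

(* s = p / q as formal power series. Since Z[[q]] is an integral domain, at
   most one s satisfies this for given p and q. *)
Definition fps_is_frac (s : fps) (p q : {poly int}) : Prop :=
  q != 0 /\ fps_mul s (fps_of_poly q) = fps_of_poly p.

Definition pdeg (p : {poly int}) : int := (size p)%:Z - 1.

(* Degree of a nonzero power series that is a rational function; fps_degE
   shows that it does not depend on the chosen fraction. *)
Definition fps_deg (s : fps) : int :=
  xget 0 [set d | exists p q : {poly int},
    [/\ p != 0, fps_is_frac s p q & d = pdeg p - pdeg q]].

Definition ideal_gf (S : set nat) : fps :=
  fun n => #|` fset_set (ideals_of_codim S n)|%fset%:Z.

Lemma bounded_finite (A : set nat) (N : nat) :
  (forall x, A x -> (x < N)%N) -> finite_set A.
Proof. by move=> AN; apply: (sub_finite_set (B := `I_N)) => // ; exact: finite_II. Qed.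

Lemma finite_bounded (A : set nat) : finite_set A ->
  exists N, forall x, A x -> (x < N)%N.
Proof.
move=> finA; exists (\max_(x <- fset_set A) x).+1 => x Ax.
rewrite ltnS; apply: (@leq_bigmax_seq _ _ xpredT id) => //.
by rewrite in_fset_set// inE.
Qed.

Lemma frobeniusP (S : set nat) : numerical_semigroup S ->
  int_gaps S (frobenius S) /\ forall z, int_gaps S z -> z <= frobenius S.
Proof.
move=> [_ /finite_bounded[N SN]].
suff: exists g, (int_gaps S `&` ubound (int_gaps S)) g.
  by move=> /(@xgetPex _ 0)[].
have gN1 : int_gaps S (-1) by case=> s _.
have gB (z : int) : int_gaps S z -> z < N%:Z.
  case: z => // z gz; rewrite ltz_nat; apply: SN => /= Sz.
  by apply: gz; exists z.
elim: N gB {SN} => [|N IH] gB.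
  by exists (-1); split=> // z /gB; rewrite -lezD1 -lerBrDr sub0r.
case: (EM (int_gaps S N)) => [gN|gN].
  by exists N%:Z; split=> // z /gB; rewrite intS addrC ltzD1.
apply: IH => z gz; have := gB _ gz; rewrite intS addrC ltzD1 le_eqVlt.
by case/orP=> // /eqP zN; case: gN; rewrite -zN.
Qed.

Lemma finite_ideal_compl (S I : set nat) : numerical_semigroup S ->
  semigroup_ideal S I -> finite_set (S `\` I).
Proof.
move=> [_ /finite_bounded[N SN]] [[i Ii] _ IS].
apply: (@bounded_finite _ (i + N)) => x [_ NIx]; rewrite ltnNge; apply/negP => le.
apply: NIx; rewrite -(@subnKC i x) ?(leq_trans (leq_addr _ _) le)//.
apply: IS => //; apply: contrapT => /SN; rewrite ltnNge leq_subRL ?le//.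
exact: leq_trans (leq_addr _ _) le.
Qed.

Lemma finite_ideals_of_codim (S : set nat) (n : nat) :
  numerical_semigroup S -> finite_set (ideals_of_codim S n).
Proof.
move=> SS; have [_ /finite_bounded[N SN]] := SS.
pose M := (n + N + N)%N.
(* If x is in S but not in I, then every y in S with x - y in S is outside I;
     this holds for all N <= y <= x - N. *)
have bnd I x : ideals_of_codim S n I -> (S `\` I) x -> (x < M)%N.
  move=> [idI cI] [Sx NIx]; rewrite ltnNge; apply/negP => le.
  have fin := finite_ideal_compl SS idI; have [_ _ IS] := idI.
  pose B := [fset (N + val k)%N | k in 'I_n.+1]%fset.
  suff: (#|` B| <= n)%N.
    rewrite card_imfset/=; last first.
      by move=> k l /addnI/val_inj.
    by rewrite size_enum_ord ltnn.
  rewrite -cI; apply/fsubset_leq_card/fsubsetP => y /imfsetP[k _ ->].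
  rewrite in_fset_set// inE; split=> /=.
    by apply: contrapT => /SN; rewrite ltnNge leq_addr.
  move=> Iy; apply: NIx.
  have leyx : (N + val k + N <= x)%N.
    by apply: leq_trans le; rewrite leq_add2r addnC leq_add2r -ltnS ltn_ord.
  rewrite -(@subnKC (N + val k) x); last exact: leq_trans (leq_addr _ _) leyx.
  apply: IS => //; apply: contrapT => /SN; rewrite ltnNge leq_subRL ?leyx//.
  exact: leq_trans (leq_addr _ _) leyx.
pose F (A : {set 'I_M}) : set nat :=
  [set x | S x /\ ~ exists2 k : 'I_M, k \in A & x = k].
apply: (@sub_finite_set _ _ (F @` setT)); last exact: finite_image.
move=> I cI; have [idI _] := cI; have [_ subI _] := idI.
exists [set k : 'I_M | `[< S k /\ ~ I k >]]%SET => //.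
apply/seteqP; split=> x /=.
  move=> [Sx Nx]; apply: contrapT => NIx; apply: Nx.
  exists (Ordinal (bnd I x cI (conj Sx NIx))) => //.
  by rewrite inE; apply/asboolP.
move=> Ix; split; first exact: subI.
by case=> k; rewrite inE => /asboolP[_ NIk] xk; apply: NIk; rewrite -xk.
Qed.

Lemma fps_mulE (s t : fps) (m n : nat) : (n < m)%N ->
  fps_mul s t n = ((\poly_(i < m) s i) * (\poly_(i < m) t i))`_n.
Proof.
move=> nm; rewrite coefM; apply: eq_bigr => i _.
have im : (i < m)%N by apply: leq_ltn_trans nm; rewrite -ltnS.
by rewrite !coef_poly im (leq_ltn_trans (leq_subr _ _) nm).
Qed.

Lemma fps_mulA (s t u : fps) :
  fps_mul s (fps_mul t u) = fps_mul (fps_mul s t) u.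
Proof.
apply/funext => n; pose P (v : fps) : {poly int} := \poly_(i < n.+1) v i.
transitivity ((P s * (P t * P u))`_n).
  rewrite coefM; apply: eq_bigr => i _; rewrite coef_poly ltn_ord.
  by rewrite (@fps_mulE t u n.+1)// ltnS leq_subr.
rewrite mulrA coefM; apply: eq_bigr => i _.
by rewrite (@fps_mulE s t n.+1)// coef_poly ltnS leq_subr.
Qed.

Lemma fps_mulC (s t : fps) : fps_mul s t = fps_mul t s.
Proof.
by apply/funext => n; rewrite !(@fps_mulE _ _ n.+1)// mulrC.
Qed.

Lemma fps_of_polyM (p q : {poly int}) :
  fps_mul (fps_of_poly p) (fps_of_poly q) = fps_of_poly (p * q).
Proof. by apply/funext => n; rewrite /fps_of_poly coefM. Qed.

Lemma fps_degE (s : fps) (p q : {poly int}) : p != 0 -> fps_is_frac s p q ->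
  fps_deg s = pdeg p - pdeg q.
Proof.
move=> p0 spq; apply: xget_unique; first by exists p, q.
move=> _ [p' [q' [p'0 [q'0 e'] ->]]]; case: spq => q0 e.
have E : p' * q = p * q'.
  have E' : fps_of_poly (p' * q) = fps_of_poly (p * q').
    rewrite -!fps_of_polyM -e -e' -!fps_mulA; congr fps_mul; exact: fps_mulC.
  by apply/polyP => n; have := congr1 (@^~ n) E'.
have := congr1 (fun r : {poly int} => size r) E.
rewrite !size_mul// /pdeg; move: p0 q0 p'0 q'0; rewrite -!size_poly_gt0.
move: (size p) (size q) (size p') (size q') => a b c d.
lia.
Qed.

(* Main.v *)
(* Translating an ideal by one raises its codimension by one, as long as the
   translate stays inside S, and every element of an ideal of codimension n is at
   least n. Let c = G(S) + 1. For n >= c the translation is therefore a bijection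
   from the ideals of codimension n to those of codimension n + 1. From
   codimension c - 1 to c it is injective and misses only the ideal c + S, whose
   translate back by one contains G(S). So (1 - q) I(q) has coefficient 1 at q^c
   and 0 beyond. *)
Require Import Defs.
From mathcomp Require Import all_boot all_order all_algebra finmap zify.
From mathcomp Require Import boolp classical_sets functions cardinality.
Set Implicit Arguments.
Unset Strict Implicit.
Unset Printing Implicit Defensive.
Import Order.TTheory GRing.Theory Num.Theory.
Local Open Scope classical_set_scope.
Local Open Scope ring_scope.

(** * Translates and counting on initial segments *)

Definition shift (k : nat) (A : set nat) : set nat := addn k @` A.

(** A count on an initial segment is meaningful for infinite sets too, so codimensions can be
    compared through [S] and its subsets by linear arithmetic. *)
Definition count_below (A : set nat) (N : nat) : nat :=
  count (fun x => `[< A x >]) (iota 0 N).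

Lemma shift_inj (k : nat) : injective (shift k).
Proof.
have sub (A B : set nat) : shift k A = shift k B -> A `<=` B.
  move=> AB x Ax; have : shift k A (k + x)%N by exists x.
  by rewrite AB => -[y By /addnI <-].
by move=> A B AB; apply/seteqP; split; apply: sub.
Qed.

Lemma count_below_shift (k : nat) (A : set nat) (N : nat) :
  count_below (shift k A) (k + N) = count_below A N.
Proof.
rewrite /count_below iotaD count_cat add0n -[X in iota X N]addn0 iotaDl count_map.
rewrite (eq_in_count (a2 := pred0)) ?count_pred0 ?add0n; last first.
  move=> x; rewrite mem_iota /= add0n => xk; apply/asboolP => -[y _ xE].
  by move: xk; rewrite -xE ltnNge leq_addr.
apply: eq_count => x /=; apply: asbool_equiv_eq; split; last by exists x.
by move=> [y Ay /addnI <-].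
Qed.

Lemma card_fset_set_bounded (A : set nat) (N : nat) :
  (forall x, A x -> (x < N)%N) -> #|` fset_set A|%fset = count_below A N.
Proof.
move=> AN; rewrite /count_below -size_filter; apply: perm_size.
apply: uniq_perm; [exact: fset_uniq|exact/filter_uniq/iota_uniq|move=> x].
rewrite mem_filter mem_iota /= add0n in_fset_set; last exact: bounded_finite AN.
apply/idP/andP => [/set_mem Ax|[/asboolP Ax _]]; last exact: mem_set.
by split; [apply/asboolP|apply: AN].
Qed.

(** The sum form avoids truncated subtraction. *)
Lemma codim_count (S A : set nat) (N : nat) : A `<=` S ->
  (forall x, (S `\` A) x -> (x < N)%N) ->
  (codim S A + count_below A N = count_below S N)%N.
Proof.
move=> AS SN; rewrite /codim (@card_fset_set_bounded _ N)// /count_below.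
elim: (iota 0 N) => //= x s <-.
case: (asboolP (A x)) => Ax.
  by rewrite (asboolT (AS _ Ax)) asboolF /=; [lia|case].
case: (asboolP (S x)) => Sx; first by rewrite asboolT; [lia|split].
by rewrite asboolF; [lia|case].
Qed.

(** * Codimension in a semigroup containing every integer from [c] on *)

Section Conductor.
Variables (S : set nat) (c : nat).
Hypothesis numS : numerical_semigroup S.
Hypothesis Sc : forall x, (c <= x)%N -> S x.

(** Passing from the bound [N] to [k + N], the count of [S] grows by [k] since [N] is at least [c],
    while the translate has as many elements below [k + N] as [A] has below [N]. *)
Lemma codim_shift (A : set nat) (k : nat) : A `<=` S -> shift k A `<=` S ->
  finite_set (S `\` A) -> codim S (shift k A) = (codim S A + k)%N.
Proof.
move=> AS kAS /finite_bounded[M SM]; pose N := maxn M c.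
have SN x : (S `\` A) x -> (x < N)%N by move=> /SM; rewrite /N; lia.
have SkN x : (S `\` shift k A) x -> (x < k + N)%N.
  move=> [Sx nx]; rewrite ltnNge; apply/negP => le; apply: nx.
  exists (x - k)%N; last by lia.
  apply: contrapT => nA; suff /SN : (S `\` A) (x - k)%N by lia.
  by split=> //; apply: Sc; move: le; rewrite /N; lia.
have := codim_count AS SN; have := codim_count kAS SkN.
have : (count_below S (k + N) = count_below S N + k)%N.
  rewrite addnC /count_below iotaD count_cat add0n; congr (_ + _)%N.
  rewrite -[RHS](size_iota N); apply/eqP; rewrite -all_count.
  apply/allP => x; rewrite mem_iota => xN; apply/asboolP/Sc.
  by move: xN; rewrite /N; lia.
by rewrite count_below_shift; lia.
Qed.

Lemma shift_ideal (I : set nat) (k : nat) : semigroup_ideal S I ->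
  shift k I `<=` S -> semigroup_ideal S (shift k I).
Proof.
move=> [[i Ii] _ IS] kIS; split=> //; first by exists (k + i)%N; exists i.
by move=> _ s [j Ij <-] Ss; exists (j + s)%N; [exact: IS|rewrite addnA].
Qed.

Lemma semigroup_ideal_self : semigroup_ideal S S.
Proof. by have [[S0 SD] _] := numS; split=> //; exists 0%N. Qed.

Lemma shift_self_sub (i : nat) : S i -> shift i S `<=` S.
Proof. by have [[_ SD] _] := numS; move=> Si _ [s Ss <-]; exact: SD. Qed.

Lemma codim_principal (i : nat) : S i -> codim S (shift i S) = i.
Proof.
move=> Si; rewrite codim_shift//; last by rewrite setDv; exact: finite_set0.
  by rewrite /codim setDv fset_set0 cardfs0.
exact: shift_self_sub.
Qed.

Lemma shift_self_sub_ideal (I : set nat) (i : nat) : semigroup_ideal S I ->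
  I i -> shift i S `<=` I.
Proof. by move=> [_ _ IS] Ii _ [s Ss <-]; exact: IS. Qed.

Lemma finite_principal_compl (i : nat) : S i -> finite_set (S `\` shift i S).
Proof.
move=> Si; apply: finite_ideal_compl => //; apply: shift_ideal.
  exact: semigroup_ideal_self.
exact: shift_self_sub.
Qed.

Lemma principal_compl_fsub (I : set nat) (i : nat) : semigroup_ideal S I ->
  I i -> (fset_set (S `\` I) `<=` fset_set (S `\` shift i S))%fset.
Proof.
move=> idI Ii; have Si : S i by case: idI => _ + _; apply.
(* Finiteness matters: [fset_set] sends infinite sets to the empty one. *)
rewrite -fset_set_sub; [|exact: finite_ideal_compl|exact: finite_principal_compl].
by move=> x [Sx nIx]; split=> // /(shift_self_sub_ideal idI Ii).
Qed.

(** The ideal contains $i + S$, whose codimension is [i]. *)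
Lemma codim_le_elem (I : set nat) (i : nat) : semigroup_ideal S I -> I i ->
  (codim S I <= i)%N.
Proof.
move=> idI Ii; have Si : S i by case: idI => _ + _; apply.
rewrite -[leqRHS](codim_principal Si).
exact/fsubset_leq_card/principal_compl_fsub.
Qed.

(** This is the equality case of [codim_le_elem]: the complements of [I] and $n + S$ are nested
    finite sets of the same size, hence equal. *)
Lemma codim_mem_principal (I : set nat) : semigroup_ideal S I ->
  I (codim S I) -> I = shift (codim S I) S.
Proof.
set n := codim S I => idI In; have Sn : S n by case: idI => _ + _; apply.
have eqC : fset_set (S `\` I) = fset_set (S `\` shift n S).
  apply/eqP; rewrite eqEfcard principal_compl_fsub//.
  by have := codim_principal Sn; rewrite /codim => ->; exact: leqnn.
apply/seteqP; split; last exact: shift_self_sub_ideal.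
move=> x Ix; apply: contrapT => nx.
have Sx : S x by case: idI => _ + _; apply.
have : x \in fset_set (S `\` shift n S).
  by rewrite in_fset_set ?inE//; exact: finite_principal_compl.
by rewrite -eqC in_fset_set ?inE; [case|exact: finite_ideal_compl].
Qed.

(** * Translation of ideals by one *)

Lemma ideal_codim_shift (n : nat) (I : set nat) : (c <= n.+1)%N ->
  ideals_of_codim S n I -> ideals_of_codim S n.+1 (shift 1 I).
Proof.
move=> cn [idI cI]; have [_ IS _] := idI.
have kIS : shift 1 I `<=` S.
  by move=> _ [i Ii <-]; apply: Sc; have := codim_le_elem idI Ii; lia.
split; first exact: shift_ideal.
by rewrite codim_shift ?cI ?addn1//; exact: finite_ideal_compl.
Qed.

(** The hypothesis [predS] keeps the translate back by one inside [S]; the codimension of that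
    translate then follows from [codim_shift]. *)
Lemma ideal_codim_unshift (n : nat) (I : set nat) :
  (forall i, I i.+1 -> S i) -> ideals_of_codim S n.+1 I ->
  exists2 J, ideals_of_codim S n J & shift 1 J = I.
Proof.
move=> predS [idI cI]; have [[i0 Ii0] IS IA] := idI.
pose J := [set i | I i.+1].
have JI : shift 1 J = I.
  apply/seteqP; split=> [_ [i Ii <-]//|[|i] Ii]; last by exists i.
  (* An ideal containing 0 would have codimension 0, not [n.+1]. *)
  by have := codim_le_elem idI Ii; rewrite cI.
have idJ : semigroup_ideal S J.
  split=> //; first by move: Ii0; rewrite -JI => -[j Jj _]; exists j.
  by move=> i s Ji Ss; rewrite /J /= -addSn; exact: IA.
exists J => //; split=> //; have [_ JS _] := idJ.
have := @codim_shift J 1 JS; rewrite JI cI addn1 => /(_ IS).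
by move=> /(_ (finite_ideal_compl numS idJ)) [].
Qed.

Lemma ideals_of_codim_stable (n : nat) : (c <= n)%N ->
  ideals_of_codim S n.+1 = shift 1 @` ideals_of_codim S n.
Proof.
move=> cn; apply/seteqP; split=> [I cI|_ [I cI <-]].
  apply: ideal_codim_unshift => // i Ii; apply: Sc.
  by have [idI] := cI; have := codim_le_elem idI Ii; lia.
by apply: ideal_codim_shift => //; lia.
Qed.

Lemma principal_of_codim (n : nat) : S n -> ideals_of_codim S n (shift n S).
Proof.
move=> Sn; split; last exact: codim_principal.
by apply: shift_ideal; [exact: semigroup_ideal_self|exact: shift_self_sub].
Qed.

(** An ideal of codimension [c] either contains [c], and is then $c + S$, or has all its elements
    above [c], and can then be translated back. *)
Lemma ideals_of_codim_conductor (g : nat) : c = g.+1 ->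
  ideals_of_codim S c = shift c S |` (shift 1 @` ideals_of_codim S g).
Proof.
move=> cg; apply/seteqP; split=> [I cI|I [->|[J cJ <-]]]; last 2 first.
- exact/principal_of_codim/Sc.
- by rewrite cg; apply: ideal_codim_shift => //; lia.
have [idI cIE] := cI; case: (EM (I c)) => Ic.
  by left; rewrite -cIE; apply: codim_mem_principal => //; rewrite cIE.
right; apply: ideal_codim_unshift; last by rewrite -cg.
move=> i Ii; apply: Sc; have := codim_le_elem idI Ii; rewrite cIE leq_eqVlt.
by case/orP=> [/eqP ci|]; [case: Ic; rewrite ci|lia].
Qed.

Lemma ideals_of_codim0 : ideals_of_codim S 0 = [set shift 0 S].
Proof.
have [[S0 _] _] := numS.
apply/seteqP; split=> [I [idI cI]|_ ->]; last exact: principal_of_codim.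
rewrite -cI; apply: codim_mem_principal => //; rewrite cI.
apply: contrapT => nI; have : (0%N \in fset_set (S `\` I)).
  by rewrite in_fset_set ?inE//; exact: finite_ideal_compl.
by move: cI; rewrite /codim => /cardfs0_eq ->; rewrite in_fset0.
Qed.

(** * Coefficients of the ideal generating function *)

Lemma card_shift_ideals (n : nat) :
  #|` fset_set (shift 1 @` ideals_of_codim S n)|%fset =
  #|` fset_set (ideals_of_codim S n)|%fset.
Proof.
rewrite fset_set_image; last exact: finite_ideals_of_codim.
by rewrite card_imfset//; exact: shift_inj.
Qed.

Lemma ideal_gf_stable (n : nat) : (c <= n)%N -> ideal_gf S n.+1 = ideal_gf S n.
Proof.
by move=> cn; rewrite /ideal_gf ideals_of_codim_stable// card_shift_ideals.
Qed.

Lemma ideal_gf0 : ideal_gf S 0 = 1.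
Proof. by rewrite /ideal_gf ideals_of_codim0 fset_set1 cardfs1. Qed.

Lemma ideal_gf_conductor (g : nat) : c = g.+1 -> ~ S g ->
  ideal_gf S c = ideal_gf S g + 1.
Proof.
move=> cg nSg; rewrite /ideal_gf (ideals_of_codim_conductor cg).
have fin := finite_ideals_of_codim g numS.
rewrite fset_setU1; last exact: finite_image.
rewrite cardfsU1 in_fset_set; last exact: finite_image.
rewrite card_shift_ideals memNset; first by rewrite -PoszD addnC.
(* The ideal $c + S$ is new: it contains $c = g + 1$, so an ideal [J] translating to it would
   contain [g]. *)
move=> [J [[_ JS _] _] JE]; apply: nSg; apply: JS.
have [[S0 _] _] := numS.
have : shift c S c by exists 0%N => //; rewrite addn0.
by rewrite -JE cg => -[j Jj [<-]].
Qed.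

End Conductor.

(** * The conductor and the resulting rational form *)

Lemma frobenius_conductor (S : set nat) : numerical_semigroup S ->
  exists c : nat, [/\ frobenius S = c%:Z - 1,
    forall x, (c <= x)%N -> S x & forall g, c = g.+1 -> ~ S g].
Proof.
move=> numS; have [gapF maxF] := frobeniusP numS.
have F1 : -1 <= frobenius S by apply: maxF; case=> s _.
(* By [F1] the sum is non-negative, so [absz] preserves it. It vanishes exactly when [S] is all of
   $\mathbb{N}$. *)
exists (absz (frobenius S + 1)); split; first by lia.
- move=> x le; apply: contrapT => nSx.
  have : int_gaps S x by move=> [s Ss [xs]]; apply: nSx; rewrite xs.
  by move/maxF; lia.
- by move=> g gE Sg; apply: gapF; exists g => //; lia.
Qed.

(** Multiplication by $1 - q$ is the backward difference, the coefficient before the first being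
    read as 0. *)
Lemma fps_mul_1subX (s : fps) (n : nat) :
  fps_mul s (fps_of_poly (1 - 'X)) n =
  s n - (if n is m.+1 then s m else 0).
Proof.
have cE i : (1 - 'X : {poly int})`_i = (i == 0%N)%:R - (i == 1%N)%:R.
  by rewrite coefB coef1 coefX.
rewrite /fps_mul /fps_of_poly; case: n => [|n].
  by rewrite big_ord1 cE subr0 mulr1 subr0.
rewrite !big_ord_recr /= subnn subSnn !cE big1 => [|i _].
  by rewrite add0r subr0 sub0r mulr1 mulrN1 addrC.
rewrite cE; have := ltn_ord i.
by case: eqP; case: eqP; rewrite ?subrr ?mulr0 //; lia.
Qed.

Theorem theorem1p2 (r : nat) (a : 'I_r -> nat) :
  numerical_semigroup (generated a) ->
  exists f : {poly int},
    [/\ fps_is_frac (ideal_gf (generated a)) f (1 - 'X),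
        frobenius (generated a) = fps_deg (ideal_gf (generated a)) &
        fps_deg (ideal_gf (generated a)) = pdeg f - 1].
Proof.
set S := generated a => numS.
have [c [FE Sc nSc]] := frobenius_conductor numS.
pose t := fps_mul (ideal_gf S) (fps_of_poly (1 - 'X)).
(* For [c = 0] this coefficient counts the single ideal of codimension 0; otherwise it is the jump
   caused by $c + S$. *)
have tc : t c = 1.
  rewrite /t fps_mul_1subX; case E: c => [|g].
    by rewrite subr0 (ideal_gf0 numS Sc).
  by rewrite -E (ideal_gf_conductor numS Sc E (nSc _ E)) addrC addKr.
(* The truncation loses nothing, as the differences vanish beyond [c]; by [tc] its degree is exactly
   [c]. *)
pose f : {poly int} := \poly_(i < c.+1) t i.
have sf : size f = c.+1 by rewrite size_poly_eq//= tc.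
have sX : size (1 - 'X : {poly int}) = 2.
  by rewrite -opprB size_polyN size_XsubC.
have fracf : fps_is_frac (ideal_gf S) f (1 - 'X).
  split; first by rewrite -size_poly_gt0 sX.
  apply/funext => n; rewrite /fps_of_poly coef_poly.
  case: ltnP => // cn; rewrite -/(t n) /t fps_mul_1subX.
  by case: n cn => // n cn; rewrite (ideal_gf_stable numS Sc)// subrr.
have f0 : f != 0 by rewrite -size_poly_gt0 sf.
exists f; rewrite (fps_degE f0 fracf); split=> //;
  by rewrite ?FE /pdeg sf sX; lia.
Qed.
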